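(* Let $d \in \mathbb N$, $\beta \in \mathbb N_0^d$ and $f \in \mathcal C^\beta(\mathbb R^d)$. Then $$\|\partial^\beta B_\alpha(f) - \partial^\beta f\|_{\mathcal C([0,1]^d)} \to 0 \quad\text{as}\quad \min_{j \in \{1, \ldots, d\}} \alpha_j \to \infty,$$ that is, for every $\epsilon > 0$ there is $N \in \mathbb N$ such that for all $\alpha = (\alpha_1,\ldots,\alpha_d) \in \mathbb N^d$ with $\min_{j} \alpha_j \ge N$ one has $\|\partial^\beta B_\alpha(f) - \partial^\beta f\|_{\mathcal C([0,1]^d)} < \epsilon$.
   Context: $\mathbb N = \{1,2,\ldots\}$, $\mathbb N_0 = \{0,1,2,\ldots\}$. For multiindices $\alpha,\beta \in \mathbb N_0^d$: $\alpha \le \beta$ means $\alpha_j \le \beta_j$ for all $j$; $\binom{\alpha}{\beta} := \prod_{j=1}^d \binom{\alpha_j}{\beta_j}$; $\partial^\beta f := \frac{\partial^{\beta_1}}{\partial x_1^{\beta_1}} \cdots \frac{\partial^{\beta_d}}{\partial x_d^{\beta_d}} f$; $x^\beta := \prod_{j=1}^d x_j^{\beta_j}$; $\mathbf 1 := (1,\ldots,1)$; and $\frac{\beta}{\alpha} := \left(\frac{\beta_1}{\alpha_1},\ldots,\frac{\beta_d}{\alpha_d}\right)$ if $\alpha \ge \mathbf 1$. For $\beta \in \mathbb N_0^d$, $\mathcal C^\beta(\mathbb R^d)$ is the set of functions $f : \mathbb R^d \to \mathbb R$ such that all the partial derivatives $\partial^\gamma f$ with $\gamma \le \beta$ exist and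 are continuous on $\mathbb R^d$. For $\alpha \in \mathbb N_0^d$ with $\alpha \ge \mathbf 1$, the multivariate Bernstein polynomial of $f$ is $$B_\alpha(f)(x) := \sum_{\gamma \in \mathbb N_0^d,\ \gamma \le \alpha} \binom{\alpha}{\gamma} f\left( \frac{\gamma}{\alpha} \right) x^\gamma (\mathbf 1 - x)^{\alpha - \gamma}.$$ For compact $K$, $\|g\|_{\mathcal C(K)} := \sup_{x \in K} |g(x)|$. *)

(* Defs.v *)
From HB Require Import structures.
From mathcomp Require Export all_boot all_order all_algebra.
From mathcomp Require Export all_classical all_reals all_analysis.
Export numFieldNormedType.Exports.

Set Implicit Arguments.
Unset Strict Implicit.
Unset Printing Implicit Defensive.

Import Order.TTheory GRing.Theory Num.Theory.
Local Open Scope classical_set_scope.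
Local Open Scope ring_scope.

(* Multiindices in N_0^d; coordinates are numbered 0, ..., d - 1. *)
Definition multiindex (d : nat) : Type := 'I_d -> nat.

Definition mi_le (d : nat) (a b : multiindex d) : bool :=
  [forall j, (a j <= b j)%N].

Definition mi_sub (d : nat) (a b : multiindex d) : multiindex d :=
  fun j => (a j - b j)%N.

Definition mi_bin (d : nat) (a b : multiindex d) : nat :=
  (\prod_(j < d) 'C(a j, b j))%N.

Section Analysis.
Variables (R : realType) (d : nat).
Implicit Types (f g : 'rV[R]_d -> R) (x : 'rV[R]_d) (a b c : multiindex d).

Definition mi_pow x b : R := \prod_(j < d) x 0 j ^+ b j.

Definition mi_div b a : 'rV[R]_d := \row_j ((b j)%:R / (a j)%:R).

Definition partial (j : 'I_d) f : 'rV[R]_d -> R :=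
  fun x => derive f x (delta_mx 0 j).

Definition has_partial (j : 'I_d) f : Prop :=
  forall x, derivable f x (delta_mx 0 j).

(* The word 0^(b 0) 1^(b 1) ... (d-1)^(b (d-1)): as in the product of
   operators defining the derivative of order b, its last letter is the
   differentiation performed first. *)
Definition mi_word b : seq 'I_d :=
  flatten [seq nseq (b j) j | j <- enum 'I_d].

Definition partials (w : seq 'I_d) f : 'rV[R]_d -> R := foldr partial f w.

(* [partials] is total (the derivative takes a default value where it does not
   exist); this is the existence, on the whole space, of every derivative
   involved. *)
Fixpoint has_partials (w : seq 'I_d) f : Prop :=
  if w is j :: w' then has_partials w' f /\ has_partial j (partials w' f)
  else True.

Definition mi_partial b f : 'rV[R]_d -> R := partials (mi_word b) f.

Definition has_mi_partial b f : Prop := has_partials (mi_word b) f.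

Definition C_class b f : Prop :=
  forall c, mi_le c b -> has_mi_partial c f /\ continuous (mi_partial c f).

(* The sum is over the multiindices c <= a, which all lie in the finite type of
   functions bounded by the largest entry of a. *)
Definition bernstein a f : 'rV[R]_d -> R := fun x =>
  \sum_(c : {ffun 'I_d -> 'I_(\max_(j < d) a j).+1} |
          mi_le (fun j => c j : nat) a)
    let g : multiindex d := fun j => c j : nat in
    (mi_bin a g)%:R * f (mi_div g a) * mi_pow x g
      * mi_pow (const_mx 1 - x) (mi_sub a g).

Definition unit_cube : set 'rV[R]_d := [set x | forall j, 0 <= x 0 j <= 1].

(* Extended-real valued, hence +oo when g is unbounded on K. *)
Definition sup_norm (K : set 'rV[R]_d) g : \bar R :=
  ereal_sup [set (`|g x|)%:E | x in K].

End Analysis.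

Arguments unit_cube R d : clear implicits.

(* Main.v *)
Require Import Defs.
From mathcomp Require Import ring lra.
Local Open Scope ring_scope.

Set Implicit Arguments.
Unset Strict Implicit.
Unset Printing Implicit Defensive.

Import Order.TTheory GRing.Theory Num.Theory.

(** Each derivative of a Bernstein polynomial is again a Bernstein-type sum:
    d/dx_j lowers the degree in x_j by one, multiplies by the old degree, and
    replaces the coefficients by their forward differences in direction j
    ([is_derive_bernstein_form]). Iterating along the word [w] of the derivative,
    the derivative of the polynomial of degree [a] is
      K * sum_c diff_w(c) * W_c(x),
    where |w| is the multiindex that counts the letters of [w], K is a product of
    falling factorials of the a_j, the weights W_c(x) are the Bernstein basis of
    degree a - |w|, nonnegative on the cube and of sum 1, and diff_w(c) is an
    iterated difference of [f] on the grid of steps 1 / a_j.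

    By the mean value theorem, applied once for each letter of [w], diff_w(c)
    is the product of the steps times g(xi_c), where g is the derivative of [f]
    along [w] and xi_c lies in the box c / a <= xi <= (c + |w|) / a
    ([mean_value]). Difference operators commute with one another, so they can be
    applied in the order in which [w] prescribes the derivatives. Altogether the
    derivative of the Bernstein polynomial at x is
      kappa * sum_c W_c(x) g(xi_c),
    where kappa, a product of factors (a_j - i) / a_j, tends to 1
    ([falling_ratio]).

    The rest is Bernstein's probabilistic argument. A continuous g satisfies
    |g u - g v| <= e + C |u - v|^2 on the cube, with C depending on e
    ([compact_modulus_sqr]), so the error is at most
      e + C * sum_c W_c(x) |xi_c - x|^2 + (1 - kappa) * sup |g|,
    and the middle term is O(1 / min a_j), because the variance of the binomial
    distribution of parameters n, t is n t (1 - t) ([sum_bernstein_poly_sqr]). *)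

(** * The univariate Bernstein basis *)

Section BernsteinBasis.
Variable R : comNzRingType.
Implicit Types (n k : nat) (t a : R).

Definition bernstein_poly n k : {poly R} :=
  'C(n, k)%:R *: ('X^k * (1 - 'X) ^+ (n - k)).

Lemma bernstein_poly_small n k : (n < k)%N -> bernstein_poly n k = 0.
Proof. by move=> nk; rewrite /bernstein_poly bin_small // scale0r. Qed.

Lemma bernstein_poly00 : bernstein_poly 0 0 = 1.
Proof. by rewrite /bernstein_poly bin0 scale1r !expr0 mulr1. Qed.

Lemma bernstein_polyS0 n :
  bernstein_poly n.+1 0 = (1 - 'X) * bernstein_poly n 0.
Proof.
by rewrite /bernstein_poly !bin0 !scale1r !subn0 !expr0 !mul1r exprS.
Qed.

(** Pascal's rule. The derivatives and the moments of the basis follow from this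
    recurrence by induction on the degree. *)
Lemma bernstein_polySS n k :
  bernstein_poly n.+1 k.+1 =
  'X * bernstein_poly n k + (1 - 'X) * bernstein_poly n k.+1.
Proof.
rewrite /bernstein_poly binS natrD scalerDl addrC subSS -!scalerAr.
congr (_ + _); first by rewrite exprS mulrA.
case: (ltnP k n) => kn; last by rewrite bin_small ?ltnS // mulr0n !scale0r.
by rewrite -(subnSK kn) [(1 - 'X) ^+ _.+1]exprS mulrCA.
Qed.

Lemma deriv_bernstein_poly n k :
  (bernstein_poly n.+1 k)^`() =
  n.+1%:R *: ((if k is k'.+1 then bernstein_poly n k' else 0)
              - bernstein_poly n k).
Proof.
have dX (p : {poly R}) : ('X * p)^`() = p + 'X * p^`().
  by rewrite derivM derivX mul1r.
have dY (p : {poly R}) : ((1 - 'X) * p)^`() = (1 - 'X) * p^`() - p.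
  by rewrite derivM derivB derivX -[1]/(1%:P) derivC; ring.
elim: n k => [|n IHn] k; rewrite -mul_polyC rmorph_nat.
  case: k => [|k].
    by rewrite bernstein_polyS0 bernstein_poly00 dY -[1]/(1%:P) derivC; ring.
  rewrite bernstein_polySS [bernstein_poly 0 k.+1]bernstein_poly_small //.
  rewrite mulr0 addr0 dX; case: k => [|k].
    by rewrite bernstein_poly00 -[1]/(1%:P) derivC; ring.
  by rewrite bernstein_poly_small // -[0]/(0%:P) derivC; ring.
case: k => [|k].
  by rewrite bernstein_polyS0 dY IHn bernstein_polyS0 -mul_polyC rmorph_nat; ring.
rewrite bernstein_polySS derivD dX dY !IHn bernstein_polySS -!mul_polyC !rmorph_nat.
by case: k => [|k]; rewrite ?bernstein_polyS0 ?bernstein_polySS; ring.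
Qed.

(** A binomial variable of parameters n + 1, t is one of parameters n, t plus an
    independent Bernoulli variable. The number of terms [N] is not tied to the
    degree, since extra basis polynomials vanish. *)
Lemma sum_bernstein_polyS N n (phi : nat -> R) t : (n < N)%N ->
  \sum_(k < N.+1) (bernstein_poly n.+1 k).[t] * phi k =
  t * (\sum_(k < N.+1) (bernstein_poly n k).[t] * phi k.+1) +
  (1 - t) * \sum_(k < N.+1) (bernstein_poly n k).[t] * phi k.
Proof.
have evalY : (1 - 'X : {poly R}).[t] = 1 - t by rewrite !hornerE.
move=> nN.
rewrite big_ord_recl bernstein_polyS0 [in X in (1 - t) * X]big_ord_recl.
rewrite [in X in t * X + _]big_ord_recr /= [bernstein_poly n N]bernstein_poly_small //.
rewrite horner0 mul0r addr0.
rewrite mulrDr addrCA; congr (_ + _); first by rewrite hornerM evalY mulrA.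
rewrite !mulr_sumr -big_split /=; apply: eq_bigr => k _.
by rewrite /bump /= add1n bernstein_polySS hornerD !hornerM evalY hornerX; ring.
Qed.

Lemma sum_bernstein_poly N n t : (n <= N)%N ->
  \sum_(k < N.+1) (bernstein_poly n k).[t] = 1.
Proof.
move=> nN; under eq_bigr => k _ do rewrite -[_.[t]]mulr1.
elim: n nN => [_|n IHn nN].
  rewrite big_ord_recl big1 => [|k _].
    by rewrite /= bernstein_poly00 -[1]/(1%:P) hornerC; ring.
  by rewrite bernstein_poly_small // horner0 mul0r.
by rewrite (sum_bernstein_polyS (fun=> 1)) // IHn ?(ltnW nN) //; ring.
Qed.

(** The second moment of the binomial distribution about an arbitrary point [a]:
    only with [a] arbitrary does the statement go through the induction, which
    shifts [a] by one. *)
Lemma sum_bernstein_poly_sqr N n t a : (n <= N)%N ->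
  \sum_(k < N.+1) (bernstein_poly n k).[t] * (k%:R - a) ^+ 2 =
  n%:R * t * (1 - t) + (n%:R * t - a) ^+ 2.
Proof.
elim: n a => [|n IHn] a nN.
  rewrite big_ord_recl big1 => [|k _].
    by rewrite /= bernstein_poly00 -[1]/(1%:P) hornerC; ring.
  by rewrite bernstein_poly_small // horner0 mul0r.
rewrite (sum_bernstein_polyS (fun k => (k%:R - a) ^+ 2)) // IHn ?(ltnW nN) //.
have shift (k : nat) : k.+1%:R - a = k%:R - (a - 1) by rewrite -natr1; ring.
under eq_bigr => k _ do rewrite shift.
by rewrite IHn ?(ltnW nN) // -natr1; ring.
Qed.

End BernsteinBasis.

Lemma bernstein_poly_ge0 (R : realDomainType) n k (t : R) :
  0 <= t <= 1 -> 0 <= (bernstein_poly R n k).[t].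
Proof.
move=> /andP[t0 t1]; rewrite /bernstein_poly !hornerE.
by rewrite !mulr_ge0 ?exprn_ge0 ?subr_ge0.
Qed.

(** * Directional derivatives *)

Section DirectionalDerivative.
Variables (R : realType) (d : nat).
Implicit Types (f : 'rV[R]_d -> R) (x v : 'rV[R]_d).

(** Reduces directional derivatives to one real variable, where the derivatives
    of polynomials and the mean value theorem are available. *)
Lemma is_derive_line f x v (t df : R) :
  is_derive (t *: v + x) v f df <->
  is_derive t 1 (fun h : R => f (h *: v + x)) df.
Proof.
have E : (fun h : R => h^-1 *: (((fun h => f (h *: v + x)) \o shift t) (h *: 1)
                                - f (t *: v + x)))
  = (fun h : R => h^-1 *: ((f \o shift (t *: v + x)) (h *: v) - f (t *: v + x))).
  apply/funext => h /=; congr (_ *: (f _ - _)).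
  by rewrite [h *: 1]mulr1 scalerDl addrA.
by split => -[df1 df2]; split; move: df1 df2; rewrite /derivable /derive E.
Qed.

Lemma is_derive_sum_fin (I : finType) (g : I -> 'rV[R]_d -> R) (dg : I -> R) x v :
  (forall i, is_derive x v (g i) (dg i)) ->
  is_derive x v (fun y => \sum_i g i y) (\sum_i dg i).
Proof.
move=> H.
have -> : (fun y => \sum_i g i y) = \sum_i g i.
  by apply/funext => y; rewrite fct_sumE.
by elim/big_ind2 : _ => // [|] *; [exact: is_derive_cst|exact: is_deriveD].
Qed.

Lemma is_derive_mul_coord (g : 'rV[R]_d -> R) (q : {poly R}) (j : 'I_d) x :
  (forall h : R, g (h *: delta_mx 0 j + x) = g x) ->
  is_derive x (delta_mx 0 j) (fun y => g y * q.[y 0 j]) (g x * q^`().[x 0 j]).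
Proof.
move=> gx; rewrite -[X in is_derive X](add0r x) -(scale0r (delta_mx 0 j)).
apply/is_derive_line.
(* on the line through x the function is a polynomial in the parameter *)
rewrite (_ : (fun h : R => _) = horner ((g x) *: (q \Po ('X + (x 0 j)%:P)))).
  rewrite (_ : g x * _ = ((g x) *: (q \Po ('X + (x 0 j)%:P)))^`().[0]).
    exact: is_derive_poly.
  rewrite derivZ deriv_comp derivD derivX derivC addr0 mulr1 hornerZ horner_comp.
  by rewrite hornerD hornerX hornerC add0r.
apply/funext => h; rewrite gx hornerZ horner_comp hornerD hornerX hornerC.
by rewrite !mxE !eqxx mulr1.
Qed.

End DirectionalDerivative.

(** * Derivatives of multivariate Bernstein forms *)

Section BernsteinForm.
Variables (R : realType) (d N : nat).
Implicit Types (F : multiindex d -> R) (x : 'rV[R]_d) (n k : multiindex d).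
Implicit Types (c : {ffun 'I_d -> 'I_N.+1}) (i j : 'I_d) (w : seq 'I_d).

Definition mi_val c : multiindex d := fun i => c i.
Definition mi_incr j n : multiindex d := fun i => (n i + (i == j))%N.
Definition mi_decr j n : multiindex d := fun i => (n i - (i == j))%N.

Definition bernstein_prod n k x : R :=
  \prod_i (bernstein_poly R (n i) (k i)).[x 0 i].

(** The index set does not depend on the degree [n]: it stays the same while
    derivatives lower [n], and the indices that do not satisfy c <= n contribute
    zero. It is also a full product set, which makes sums of products factor. *)
Definition bernstein_form n F x : R :=
  \sum_c F (mi_val c) * bernstein_prod n (mi_val c) x.

Lemma bernsteinE (a : multiindex d) (f : 'rV[R]_d -> R) x :
  N = (\max_j a j)%N ->
  bernstein a f x = bernstein_form a (fun k => f (mi_div R k a)) x.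
Proof.
move=> NE; rewrite /bernstein -NE big_mkcond /=; apply: eq_bigr => c _.
case: ifPn => [_|/forallPn[j caj]]; last first.
  rewrite /bernstein_prod (bigD1 j) //= bernstein_poly_small ?ltnNge //.
  by rewrite horner0 mul0r mulr0.
rewrite -/(mi_val c) -!mulrA mulrCA; congr (_ * _).
rewrite /mi_bin /mi_pow /mi_sub natr_prod -!big_split /=; apply: eq_bigr => j _.
by rewrite /bernstein_poly !mxE hornerZ hornerM !hornerE /=.
Qed.

Lemma is_derive_bernstein_prod n k x j :
  is_derive x (delta_mx 0 j) (bernstein_prod n k)
    ((\prod_(i | i != j) (bernstein_poly R (n i) (k i)).[x 0 i]) *
      (bernstein_poly R (n j) (k j))^`().[x 0 j]).
Proof.
pose g (y : 'rV[R]_d) := \prod_(i | i != j) (bernstein_poly R (n i) (k i)).[y 0 i].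
rewrite (_ : bernstein_prod n k =
  fun y => g y * (bernstein_poly R (n j) (k j)).[y 0 j]); last first.
  by apply/funext => y; rewrite /bernstein_prod (bigD1 j) //= mulrC.
apply: (is_derive_mul_coord (g := g)) => h.
by apply: eq_bigr => i ij; rewrite !mxE (negbTE ij) andbF mulr0 add0r.
Qed.

(** Summation by parts needs the shift of the j-th index. Shifting cyclically,
    that is, modulo N + 1, permutes the whole index set; the index that wraps
    around is the one where both summands vanish. *)
Lemma sum_shift j (G H : multiindex d -> R) :
  (0 < N)%N ->
  (forall k, k j = 0%N -> G k = 0) ->
  (forall k, k j = N -> H k = 0) ->
  (forall k, G (mi_incr j k) = H k) ->
  \sum_c G (mi_val c) = \sum_c H (mi_val c).
Proof.
move=> N0 G0 HN GH.
pose e : {ffun 'I_d -> 'I_N.+1} := [ffun i => if i == j then inord 1 else 0].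
rewrite (reindex_inj (addIr e)) /=; apply: eq_bigr => c _.
have cE i : mi_val (c + e) i = if i == j then ((c j).+1 %% N.+1)%N else c i.
  rewrite /mi_val !ffunE /=; case: eqP => [->|_] /=.
    by rewrite inordK ?ltnS // addn1.
  by rewrite addn0 modn_small.
have [cN|cN] := eqVneq (c j : nat) N.
  by rewrite HN // G0 // cE eqxx cN modnn.
rewrite -GH; congr (G _); apply/funext => i; rewrite cE /mi_incr /mi_val.
case: eqP => [->|_]; last by rewrite addn0.
by rewrite addn1 modn_small // ltnS ltn_neqAle cN -ltnS /=.
Qed.

Lemma is_derive_bernstein_form n F x j :
  (0 < n j)%N -> (n j <= N)%N ->
  is_derive x (delta_mx 0 j) (bernstein_form n F)
   ((n j)%:R *
    bernstein_form (mi_decr j n) (fun k => F (mi_incr j k) - F k) x).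
Proof.
move=> n0 nN; pose p m := (bernstein_poly R (n j).-1 m).[x 0 j].
pose P k := \prod_(i | i != j) (bernstein_poly R (n i) (k i)).[x 0 i].
have decE k : bernstein_prod (mi_decr j n) k x = P k * p (k j).
  rewrite /bernstein_prod (bigD1 j) //= mulrC /mi_decr eqxx subn1.
  congr (_ * _).
  by apply: eq_bigr => i ij; rewrite (negbTE ij) subn0.
have D : is_derive x (delta_mx 0 j) (bernstein_form n F)
  (\sum_c F (mi_val c) *
     (P (mi_val c) * (bernstein_poly R (n j) (c j))^`().[x 0 j])).
  apply: is_derive_sum_fin => c.
  exact: (@is_deriveZ _ _ _ _ (F (mi_val c)) _ _ _
           (is_derive_bernstein_prod n (mi_val c) x j)).
apply: (is_derive_eq D).
pose G k := F k * (P k * (if k j is m.+1 then p m else 0)).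
pose H k := F (mi_incr j k) * (P k * p (k j)).
have GH : \sum_c G (mi_val c) = \sum_c H (mi_val c).
  apply: (@sum_shift j).
  - exact: leq_trans nN.
  - by move=> k kj; rewrite /G kj !mulr0.
  - move=> k kj.
    by rewrite /H /p kj bernstein_poly_small ?prednK // horner0 !mulr0.
  - move=> k; rewrite /G /H.
    have -> : mi_incr j k j = (k j).+1 by rewrite /mi_incr eqxx addn1.
    congr (_ * (_ * _)).
    by apply: eq_bigr => i ij; rewrite /mi_incr (negbTE ij) addn0.
transitivity ((n j)%:R * (\sum_c G (mi_val c)
    - \sum_c F (mi_val c) * bernstein_prod (mi_decr j n) (mi_val c) x)).
  rewrite -sumrB mulr_sumr; apply: eq_bigr => c _.
  rewrite decE /G /p -{1}(prednK n0) deriv_bernstein_poly (prednK n0).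
  rewrite hornerZ hornerD hornerN /mi_val.
  by case: (nat_of_ord (c j)) => [|m]; rewrite ?horner0; ring.
rewrite GH -sumrB; congr (_ * _); apply: eq_bigr => c _.
by rewrite /H decE; ring.
Qed.

Fixpoint mi_diffs w F : multiindex d -> R :=
  if w is j :: w' then
    (fun k => mi_diffs w' F (mi_incr j k) - mi_diffs w' F k)
  else F.

Fixpoint mi_decrs w n : multiindex d :=
  if w is j :: w' then mi_decr j (mi_decrs w' n) else n.

(** A product of falling factorials: if the letter [j] occurs m times in [w], it
    contributes n_j (n_j - 1) ... (n_j - m + 1). *)
Fixpoint mi_falling w n : R :=
  if w is j :: w' then mi_falling w' n * (mi_decrs w' n j)%:R else 1.

Lemma mi_decrsE w n i : mi_decrs w n i = (n i - count_mem i w)%N.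
Proof.
elim: w => [|j w IH] /=; first by rewrite subn0.
by rewrite /mi_decr IH -subnDA addnC eq_sym.
Qed.

Lemma partials_bernstein_form w n F :
  (forall i, (count_mem i w <= n i)%N) -> (forall i, (n i <= N)%N) ->
  partials w (bernstein_form n F) =
  fun x => mi_falling w n * bernstein_form (mi_decrs w n) (mi_diffs w F) x.
Proof.
move=> wn nN; elim: w wn => [|j w IH] wn /=.
  by apply/funext => x; rewrite mul1r.
rewrite IH => [|i]; last by apply: leq_trans (wn i); rewrite leq_addl.
have nj : (0 < mi_decrs w n j)%N.
  by rewrite mi_decrsE subn_gt0; apply: leq_trans (wn j) => /=; rewrite eqxx.
have njN : (mi_decrs w n j <= N)%N.
  by rewrite mi_decrsE (leq_trans (leq_subr _ _)).
apply/funext => x; rewrite -mulrA.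
have D := @is_deriveZ _ _ _ _ (mi_falling w n) _ _ _
            (is_derive_bernstein_form (mi_diffs w F) x nj njN).
exact: (@derive_val _ _ _ _ _ _ _ D).
Qed.

(** ** The basis as a probability distribution on the index set *)

Lemma bernstein_prod_ge0 n k x :
  unit_cube R d x -> 0 <= bernstein_prod n k x.
Proof. by move=> Kx; apply: prodr_ge0 => i _; apply: bernstein_poly_ge0. Qed.

Lemma sum_bernstein_prod n x : (forall i, (n i <= N)%N) ->
  \sum_c bernstein_prod n (mi_val c) x = 1.
Proof.
move=> nN; rewrite /bernstein_prod /mi_val.
rewrite -(bigA_distr_bigA
  (fun i (k : 'I_N.+1) => (bernstein_poly R (n i) k).[x 0 i])) /=.
by rewrite big1 // => i _; rewrite sum_bernstein_poly.
Qed.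

(** The weights form a product distribution; its j-th marginal is binomial. *)
Lemma sum_bernstein_prod_coord n x j (phi : nat -> R) :
  (forall i, (n i <= N)%N) ->
  \sum_c bernstein_prod n (mi_val c) x * phi (c j) =
  \sum_(k < N.+1) (bernstein_poly R (n j) k).[x 0 j] * phi k.
Proof.
move=> nN; pose G i (k : 'I_N.+1) :=
  (bernstein_poly R (n i) k).[x 0 i] * (if i == j then phi k else 1).
transitivity (\sum_(c : {ffun 'I_d -> 'I_N.+1}) \prod_i G i (c i)).
  apply: eq_bigr => c _; rewrite /G big_split /=; congr (_ * _).
  by rewrite -big_mkcond /= big_pred1_eq.
rewrite -bigA_distr_bigA (bigD1 j) //= [X in _ * X]big1 => [|i ij].
  by rewrite mulr1; apply: eq_bigr => k _; rewrite /G eqxx.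
rewrite -[RHS](sum_bernstein_poly (x 0 i) (nN i)).
by apply: eq_bigr => k _; rewrite /G (negbTE ij) /= mulr1.
Qed.

Lemma sum_bernstein_prod_var n x j : (forall i, (n i <= N)%N) ->
  \sum_c bernstein_prod n (mi_val c) x * ((c j)%:R - (n j)%:R * x 0 j) ^+ 2 =
  (n j)%:R * x 0 j * (1 - x 0 j).
Proof.
move=> nN.
rewrite (sum_bernstein_prod_coord x j (fun k : nat => (k%:R - (n j)%:R * x 0 j) ^+ 2)) //.
by rewrite sum_bernstein_poly_sqr // subrr expr0n addr0.
Qed.

End BernsteinForm.

(** * Iterated differences and the mean value theorem *)

Section MeanValue.
Variables (R : realType) (d : nat).
Implicit Types (f g : 'rV[R]_d -> R) (x y u v : 'rV[R]_d) (w : seq 'I_d).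
Implicit Types (h : 'I_d -> R).
Local Open Scope classical_set_scope.

Definition increment v f : 'rV[R]_d -> R := fun y => f (y + v) - f y.

Fixpoint increments h w f : 'rV[R]_d -> R :=
  if w is j :: w' then increment (h j *: delta_mx 0 j) (increments h w' f)
  else f.

Lemma increments_increment h w v f :
  increments h w (increment v f) = increment v (increments h w f).
Proof.
elim: w => //= j w ->; apply/funext => y; rewrite /increment.
by rewrite (addrAC y v); ring.
Qed.

Lemma mi_diffs_increments w (a k : multiindex d) f :
  mi_diffs w (fun k => f (mi_div R k a)) k =
  increments (fun j => (a j)%:R^-1) w f (mi_div R k a).
Proof.
elim: w k => //= j w IH k; rewrite !IH /increment.
congr (increments _ _ _ _ - _).
apply/rowP => i; rewrite !mxE /mi_incr natrD mulrDl; congr (_ + _).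
by case: eqVneq => [->|_]; rewrite ?mul1r ?mulr1 ?mul0r ?mulr0.
Qed.

Lemma is_derive_increment f v x u :
  derivable f x u -> derivable f (x + v) u ->
  is_derive x u (increment v f) (derive f (x + v) u - derive f x u).
Proof.
move=> fx fxv; apply: is_deriveB; last exact: derivableP.
have E : (fun h : R => h^-1 *: (((fun y => f (y + v)) \o shift x) (h *: u)
                                - f (x + v)))
   = (fun h : R => h^-1 *: ((f \o shift (x + v)) (h *: u) - f (x + v))).
  by apply/funext => h /=; rewrite addrA.
by split; move: fxv; rewrite /derivable /derive E.
Qed.

Lemma partials_increment w f v : has_partials w f ->
  has_partials w (increment v f) /\
  partials w (increment v f) = increment v (partials w f).
Proof.
elim: w => //= j w IH [/IH[H E] D].
have D' x := is_derive_increment (D x) (D (x + v)).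
split.
  by split=> // x; rewrite E; exact: (@ex_derive _ _ _ _ _ _ _ (D' x)).
by apply/funext => x; rewrite E; exact: (@derive_val _ _ _ _ _ _ _ (D' x)).
Qed.

Lemma mean_value_coord f j (h : R) y : has_partial j f -> 0 <= h ->
  exists2 s, 0 <= s <= h &
    increment (h *: delta_mx 0 j) f y = h * partial j f (y + s *: delta_mx 0 j).
Proof.
move=> fj h0; pose phi t := f (t *: delta_mx 0 j + y).
have D (t : R) :
    is_derive t (1 : R) phi (partial j f (t *: delta_mx 0 j + y)).
  by apply/is_derive_line; apply: derivableP; apply: fj.
have cphi : {within `[0, h], continuous phi}.
  apply: derivable_within_continuous => t _.
  exact: (@ex_derive _ _ _ _ _ _ _ (D t)).
have [s sI E] := MVT_segment h0 (fun t _ => D t) cphi.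
exists s; first by move: sI; rewrite in_itv.
rewrite [y + s *: _]addrC; move: E.
rewrite /phi scale0r add0r subr0 mulrC => <-.
by rewrite /increment (addrC y).
Qed.

(** The induction applies its hypothesis to the increment of [f] in the direction
    of the first letter, since the difference operators commute, and only then
    the one-dimensional mean value theorem to the derivative obtained. *)
Lemma mean_value h w f y : (forall j, 0 <= h j) -> has_partials w f ->
  exists2 xi : 'rV[R]_d,
    (forall i, y 0 i <= xi 0 i <= y 0 i + (count_mem i w)%:R * h i) &
    increments h w f y = (\prod_(j <- w) h j) * partials w f xi.
Proof.
move=> h0; elim: w f y => [|j w IH] f y /=.
  move=> _; exists y => [i|]; first by rewrite mul0r addr0 lexx.
  by rewrite big_nil mul1r.
move=> [Hw Hj].
have [Hw' E'] := partials_increment (h j *: delta_mx 0 j) Hw.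
have [xi xiI E] := IH _ y Hw'.
rewrite -increments_increment E E'.
have [s /andP[s0 sh] ->] := mean_value_coord xi Hj (h0 j).
exists (xi + s *: delta_mx 0 j); last by rewrite big_cons; ring.
move=> i; have /andP[y1 y2] := xiI i; rewrite !mxE /= eq_sym natrD mulrDl.
case: eqVneq => [ij|_] /=; last by rewrite mulr0 mul0r !addr0 add0r y1 y2.
by subst i; rewrite mulr1 mul1r; apply/andP; split; lra.
Qed.

End MeanValue.

(** * Continuous functions on compact sets *)

Section CompactContinuity.
Variables (R : realType) (d : nat) (K : set 'rV[R]_d).
Implicit Types (g : 'rV[R]_d -> R) (u v : 'rV[R]_d).
Local Open Scope classical_set_scope.

Lemma compact_unif_continuous g (e : R) :
  compact K -> continuous g -> 0 < e ->
  exists2 r : R, 0 < r & forall u v, K u -> ball u r v -> `|g u - g v| < e.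
Proof.
move=> cK cg e0.
have H : \forall r \near (0:R)^'+,
    K `<=` (fun u => forall v, ball u r v -> `|g u - g v| < e).
  apply: (@compact_near_coveringP _ K).1 cK R _
    (fun r u => forall v, ball u r v -> `|g u - g v| < e) _ _.
  move=> u Ku.
  have : nbhs u [set v | `|g u - g v| < e / 2].
    have e2 : 0 < e / 2 by lra.
    by move/cvgrPdist_lt : (cg u) => /(_ _ e2).
  move=> /nbhs_ballP[r /= r0 Hr].
  exists (ball u (r / 2), [set t | t < r / 2])%classic => /=.
    split; first by apply: nbhsx_ballx; lra.
    by apply: nbhs_right_lt; lra.
  move=> [u' t] /= [uu' tr] v uv.
  have uv' : ball u r v.
    by rewrite [r]splitr; apply: ball_triangle uu' _; apply: le_ball uv; exact: ltW.
  have uu2 : ball u r u' by apply: le_ball uu'; lra.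
  have /= gv := Hr _ uv'; have /= gu' := Hr _ uu2.
  rewrite (_ : g u' - g v = (g u - g v) - (g u - g u')); last by ring.
  by apply: le_lt_trans (ler_normB _ _) _; lra.
near (0:R)^'+ => r; exists r; first by near: r; exact: nbhs_right_gt.
by move=> u v Ku; apply: (near H r).
Unshelve. all: by end_near.
Qed.

Lemma compact_norm_bounded g : compact K -> continuous g ->
  exists2 M : R, 0 <= M & forall u, K u -> `|g u| <= M.
Proof.
move=> cK cg; have [K0|K0] := pselect (K !=set0); last first.
  by exists 0 => // u Ku; case: K0; exists u.
have cn : {within K, continuous (fun u => `|g u|)}.
  apply: continuous_subspaceT => u.
  exact: continuous_comp (cg u) (@norm_continuous _ _ (g u)).
have [c _ Hc] := EVT_max_rV K0 cK cn.
by exists `|g c| => // u Ku; apply: Hc; rewrite inE.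
Qed.

(** Uniform continuity in a form that can be averaged: points closer than the
    radius of uniform continuity are covered by [e], the other ones by the
    quadratic term, because |g u - g v| is at most twice the maximum of |g|. *)
Lemma compact_modulus_sqr g (e : R) :
  compact K -> continuous g -> 0 < e ->
  exists2 C : R, 0 <= C & forall u v, K u -> K v ->
   `|g u - g v| <= e + C * \sum_j (u 0 j - v 0 j) ^+ 2.
Proof.
move=> cK cg e0; have [r r0 Hr] := compact_unif_continuous cK cg e0.
have [M M0 HM] := compact_norm_bounded cK cg.
have C0 : 0 <= 2 * M / r ^+ 2 by rewrite divr_ge0 ?exprn_ge0 ?mulr_ge0 // ltW.
exists (2 * M / r ^+ 2) => // u v Ku Kv.
have S0 : 0 <= \sum_j (u 0 j - v 0 j) ^+ 2.
  by apply: sumr_ge0 => j _; exact: sqr_ge0.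
have [uv|uv] := pselect (ball u r v).
  by apply: (le_trans (ltW (Hr _ _ Ku uv))); rewrite lerDl mulr_ge0.
have [j uvj] : exists j, r <= `|u 0 j - v 0 j|.
  apply: contrapT => H; apply: uv; split=> // i k; rewrite ord1.
  by apply: contrapT => H'; apply: H; exists k; rewrite leNgt; apply/negP.
have {uvj}rS : r ^+ 2 <= \sum_j (u 0 j - v 0 j) ^+ 2.
  apply: le_trans (_ : (u 0 j - v 0 j) ^+ 2 <= _).
    by rewrite -[X in _ <= X]real_normK ?num_real // lerXn2r ?nnegrE // ltW.
  by rewrite (bigD1 j) //= lerDl sumr_ge0 // => k _; exact: sqr_ge0.
apply: le_trans (_ : 2 * M <= _).
  apply: le_trans (ler_normB _ _) _.
  by have := HM _ Ku; have := HM _ Kv; lra.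
apply: le_trans (_ : 2 * M / r ^+ 2 * r ^+ 2 <= _).
  by rewrite divfK // expf_neq0 // gt_eqF.
by apply: ler_wpDl; [exact: ltW | exact: ler_wpM2l].
Qed.

End CompactContinuity.

Lemma compact_unit_cube (R : realType) d : compact (unit_cube R d).
Proof.
have := @rV_compact R d (fun=> `[0, 1]%classic) (fun=> @segment_compact R 0 1).
by congr compact; apply/seteqP; split=> x /= H j; have := H j; rewrite in_itv.
Qed.

(** * The error estimate *)

Section ErrorEstimate.
Variables (R : realType) (d : nat).
Implicit Types (w : seq 'I_d) (a : multiindex d).

(** The ratio is a product of one factor (a_j - i) / a_j with i < size w for each
    letter of [w], so that each factor differs from 1 by at most size w / m. *)
Lemma falling_ratio w a (m : nat) : (0 < m)%N -> (forall i, (m <= a i)%N) ->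
  let kappa := mi_falling R w a * \prod_(j <- w) (a j)%:R^-1 in
  0 <= kappa <= 1 /\ 1 - kappa <= (size w)%:R ^+ 2 / m%:R.
Proof.
move=> m0 ma; elim: w => [|j w [/andP[IH0 IH1] IH]] /=.
  by rewrite big_nil mulr1 ler01 lexx subrr expr0n mul0r.
rewrite big_cons; set kappa := mi_falling R w a * _ in IH0 IH1 IH.
pose t : R := (mi_decrs w a j)%:R / (a j)%:R.
have -> : mi_falling R w a * (mi_decrs w a j)%:R *
    ((a j)%:R^-1 * \prod_(i <- w) (a i)%:R^-1) = kappa * t.
  by rewrite /kappa /t; ring.
have a0 : 0 < (a j)%:R :> R by rewrite ltr0n (leq_trans m0).
have m0' : 0 < m%:R :> R by rewrite ltr0n.
have t0 : 0 <= t by rewrite divr_ge0.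
have t1 : t <= 1 by rewrite ler_pdivrMr // mul1r ler_nat mi_decrsE leq_subr.
have t2 : 1 - t <= (size w)%:R / m%:R.
  apply: le_trans (_ : (size w)%:R / (a j)%:R <= _); last first.
    by apply: ler_wpM2l => //; rewrite lef_pV2 ?posrE // ler_nat.
  rewrite ler_pdivlMr // mulrBl mul1r divfK ?gt_eqF // lerBlDr -natrD ler_nat.
  by rewrite mi_decrsE -leq_subLR leq_sub2l //; exact: count_size.
split; first by rewrite mulr_ge0 //= mulr_ile1.
have -> : 1 - kappa * t = (1 - kappa) + kappa * (1 - t) by ring.
have k1 : kappa * (1 - t) <= (size w)%:R / m%:R.
  by apply: le_trans t2; rewrite ler_piMl // subr_ge0.
apply: le_trans (lerD IH k1) _.
rewrite -mulrDl; apply: ler_wpM2r; first by rewrite invr_ge0 ltW.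
by have := ler0n R (size w); rewrite -[(size w).+1%:R]natr1; nra.
Qed.

(** Compares the mean value point with x through the centred index c - (a - p) x,
    whose mean square is a binomial variance: a (xi - x) is this index plus
    (a xi - c) - p x, a difference of two numbers of [0, p]. *)
Lemma sqr_dev (a c p s : R) (xi x : R) :
  0 < a -> 0 <= x <= 1 -> 0 <= p <= s -> c <= a * xi <= c + p ->
  (xi - x) ^+ 2 <= 2 * ((c - (a - p) * x) ^+ 2 + s ^+ 2) / a ^+ 2.
Proof.
move=> a0 /andP[x0 x1] /andP[p0 ps] /andP[h1 h2].
rewrite ler_pdivlMr ?exprn_gt0 // -exprMn.
set u := c - (a - p) * x; pose r := (a * xi - c) - p * x.
have -> : (xi - x) * a = u + r by rewrite /u /r; ring.
have rs : r ^+ 2 <= s ^+ 2.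
  have s0 : 0 <= s := le_trans p0 ps.
  have px0 : 0 <= p * x by rewrite mulr_ge0.
  have px1 : p * x <= p by rewrite ler_piMr.
  rewrite -[X in X <= _]real_normK ?num_real // lerXn2r ?nnegrE //.
  by rewrite ler_norml; apply/andP; split; rewrite /r; lra.
by have := sqr_ge0 (u - r); move: u r rs => u r rs; nra.
Qed.

(** A mean value point exists, and lies in the cube, when c <= n. For the other
    indices the weight vanishes; x itself is taken. *)
Lemma mean_value_point w (f : 'rV[R]_d -> R) a N x (c : {ffun 'I_d -> 'I_N.+1}) :
  let n := mi_decrs w a in
  let W := bernstein_prod n (mi_val c) x in
  has_partials w f -> (forall i, (0 < a i)%N) ->
  (forall i, (count_mem i w <= a i)%N) -> unit_cube R d x ->
  exists xi : 'rV[R]_d,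
  [/\ unit_cube R d xi,
     mi_diffs w (fun k => f (mi_div R k a)) (mi_val c) * W =
        (\prod_(j <- w) (a j)%:R^-1) * partials w f xi * W &
     forall j, W * (xi 0 j - x 0 j) ^+ 2 <=
       W * (2 * (((c j)%:R - (n j)%:R * x 0 j) ^+ 2 + (size w)%:R ^+ 2)
              / (a j)%:R ^+ 2)].
Proof.
move=> n W Hf apos wa Kx.
have a0 i : 0 < (a i)%:R :> R by rewrite ltr0n.
pose h j : R := (a j)%:R^-1.
have h0 j : 0 <= h j by rewrite invr_ge0.
have W0 : 0 <= W by exact: bernstein_prod_ge0.
have [/forallP cn|/forallPn[j cj]] := boolP [forall j, (c j <= n j)%N]; last first.
  have -> : W = 0.
    rewrite /W /bernstein_prod (bigD1 j) //= bernstein_poly_small ?ltnNge //.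
    by rewrite horner0 mul0r.
  by exists x; split=> // [|j']; rewrite ?mulr0 ?mul0r.
have [xi xiI E] := mean_value (mi_div R (mi_val c) a) h0 Hf.
have xib j : (c j)%:R <= (a j)%:R * xi 0 j <= (c j)%:R + (count_mem j w)%:R.
  have := xiI j; rewrite !mxE /h -mulrDl /mi_val => /andP[h1 h2].
  by rewrite mulrC -ler_pdivrMr // h1 /= -ler_pdivlMr.
have nE j : (n j)%:R = (a j)%:R - (count_mem j w)%:R :> R.
  by rewrite /n mi_decrsE natrB.
exists xi; split.
- move=> j; have /andP[h1 h2] := xib j.
  have c0 : 0 <= (c j)%:R :> R by [].
  have cn' : (c j)%:R <= (n j)%:R :> R by rewrite ler_nat.
  rewrite nE in cn'.
  rewrite -(ler_pM2l (a0 j)) mulr0 -[X in _ && X](ler_pM2l (a0 j)) mulr1.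
  by apply/andP; split; lra.
- by rewrite mi_diffs_increments E.
- move=> j; apply: ler_wpM2l => //; rewrite nE.
  apply: sqr_dev => //.
  by rewrite ler0n ler_nat count_size.
Qed.

Lemma bernstein_partials_error w (f : 'rV[R]_d -> R) a (m : nat) (e C M : R) x :
  let g := partials w f in let s := (size w)%:R : R in
  has_partials w f ->
  (0 < m)%N -> (size w <= m)%N -> (forall i, (m <= a i)%N) -> 0 <= C ->
  (forall u v, unit_cube R d u -> unit_cube R d v ->
    `|g u - g v| <= e + C * \sum_j (u 0 j - v 0 j) ^+ 2) ->
  (forall u, unit_cube R d u -> `|g u| <= M) ->
  unit_cube R d x ->
  `|partials w (bernstein a f) x - g x| <=
  e + (C * d%:R * (2 * (1 + s ^+ 2)) + s ^+ 2 * M) / m%:R.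
Proof.
move=> g s Hf m0 wm ma C0 gC gM Kx.
pose N := (\max_j a j)%N.
have aN i : (a i <= N)%N by exact: leq_bigmax.
have wa i : (count_mem i w <= a i)%N.
  by apply: leq_trans (ma i); apply: leq_trans wm; exact: count_size.
pose n := mi_decrs w a.
have nN i : (n i <= N)%N by rewrite /n mi_decrsE (leq_trans (leq_subr _ _)).
have apos i : (0 < a i)%N by exact: leq_trans (ma i).
have a0 i : 0 < (a i)%:R :> R by rewrite ltr0n.
have m0' : 0 < m%:R :> R by rewrite ltr0n.
pose F k := f (mi_div R k a).
have -> : bernstein a f = bernstein_form N a F.
  by apply/funext => y; exact: bernsteinE.
rewrite partials_bernstein_form // -/n.
pose W (c : {ffun 'I_d -> 'I_N.+1}) := bernstein_prod n (mi_val c) x.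
have W0 c : 0 <= W c by exact: bernstein_prod_ge0.
have [xi xiP] := choice (fun c : {ffun 'I_d -> 'I_N.+1} =>
  mean_value_point c Hf apos wa Kx).
have [/andP[k0 k1] k2] := falling_ratio w m0 ma.
set kappa := mi_falling R w a * _ in k0 k1 k2.
have SW : \sum_c W c = 1 by exact: sum_bernstein_prod.
have -> : mi_falling R w a * bernstein_form N n (mi_diffs w F) x - g x
  = kappa * (\sum_c W c * (g (xi c) - g x)) - (1 - kappa) * g x.
  under [in RHS]eq_bigr => c _ do rewrite mulrBr.
  rewrite sumrB -mulr_suml SW mul1r.
  have -> : bernstein_form N n (mi_diffs w F) x =
    (\prod_(j <- w) (a j)%:R^-1) * \sum_c W c * g (xi c).
    rewrite mulr_sumr; apply: eq_bigr => c _; have [_ -> _] := xiP c.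
    by rewrite -mulrA [partials _ _ _ * _]mulrC.
  by rewrite /kappa; ring.
apply: le_trans (ler_normB _ _) _.
rewrite [X in _ <= _ + X]mulrDl addrA; apply: lerD; last first.
  rewrite normrM ger0_norm ?subr_ge0 // mulrAC.
  by apply: ler_pM => //; rewrite ?subr_ge0 //; exact: gM.
rewrite normrM ger0_norm //.
apply: le_trans (_ : `|\sum_c W c * (g (xi c) - g x)| <= _).
  by rewrite ler_piMl.
apply: le_trans (ler_norm_sum _ _ _) _.
apply: le_trans (_ : \sum_c W c * (e + C * \sum_j (xi c 0 j - x 0 j) ^+ 2) <= _).
  apply: ler_sum => c _; rewrite normrM ger0_norm //; apply: ler_wpM2l => //.
  by have [Kxi _ _] := xiP c; exact: gC.
under eq_bigr => c _ do rewrite mulrDr mulrCA mulr_sumr.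
rewrite big_split /= -mulr_suml SW mul1r lerD2l -mulr_sumr -!mulrA.
apply: ler_wpM2l => //; rewrite exchange_big /=.
apply: le_trans (_ : \sum_(j < d) (2 * (1 + s ^+ 2)) / m%:R <= _); last first.
  by rewrite sumr_const card_ord -[_ *+ d]mulr_natl !mulrA.
(* mean square distance in one coordinate: the variance is at most a_j *)
apply: ler_sum => j _.
pose V (c : {ffun 'I_d -> 'I_N.+1}) := ((c j)%:R - (n j)%:R * x 0 j) ^+ 2.
apply: (@le_trans _ _ (\sum_c W c * (2 * (V c + s ^+ 2) / (a j)%:R ^+ 2))).
  by apply: ler_sum => c _; have [_ _] := xiP c; exact.
have WV c : W c * (2 * (V c + s ^+ 2) / (a j)%:R ^+ 2) =
    2 / (a j)%:R ^+ 2 * (W c * V c + W c * s ^+ 2) by ring.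
under eq_bigr => c _ do rewrite WV.
rewrite -mulr_sumr big_split /= -mulr_suml SW mul1r sum_bernstein_prod_var //.
have /andP[x0 x1] := Kx j.
have na : (n j)%:R <= (a j)%:R :> R by rewrite ler_nat /n mi_decrsE leq_subr.
have v1 : (n j)%:R * x 0 j * (1 - x 0 j) <= (a j)%:R.
  rewrite -mulrA; apply: le_trans na; rewrite ler_piMr //.
  by rewrite mulr_ile1 ?subr_ge0 // gerBl.
have a1 : 1 <= (a j)%:R :> R by rewrite ler1n.
have s2 : s ^+ 2 <= (a j)%:R * s ^+ 2 by rewrite ler_peMl ?sqr_ge0.
apply: (@le_trans _ _ (2 / (a j)%:R ^+ 2 * ((a j)%:R * (1 + s ^+ 2)))).
  apply: ler_wpM2l; first by rewrite divr_ge0 ?sqr_ge0.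
  by rewrite [X in _ <= X]mulrDr mulr1; apply: lerD.
have -> : 2 / (a j)%:R ^+ 2 * ((a j)%:R * (1 + s ^+ 2))
    = 2 * (1 + s ^+ 2) / (a j)%:R.
  by field; rewrite gt_eqF.
apply: ler_wpM2l; first by rewrite mulr_ge0 // addr_ge0 ?sqr_ge0.
by rewrite lef_pV2 ?posrE // ler_nat.
Qed.

(** The constants of the error bound depend on [f], [w] and [eps] only, so its
    numerator is fixed before the degree is chosen. *)
Lemma bernstein_partials_cvg w (f : 'rV[R]_d -> R) :
  has_partials w f -> continuous (partials w f) ->
  forall eps : R, 0 < eps ->
    exists N : nat, (0 < N)%N /\
      forall a, (forall j, (N <= a j)%N) ->
        (sup_norm (unit_cube R d)
           (fun x => (partials w (bernstein a f) x - partials w f x)%R)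
         < eps%:E)%E.
Proof.
move=> Hf cf eps eps0.
have e4 : 0 < eps / 4 by lra.
have [C C0 gC] := compact_modulus_sqr (@compact_unit_cube R d) cf e4.
have [M M0 gM] := compact_norm_bounded (@compact_unit_cube R d) cf.
pose D := C * d%:R * (2 * (1 + (size w)%:R ^+ 2)) + (size w)%:R ^+ 2 * M.
pose m := (maxn (size w) (Num.truncn (D / (eps / 4)))).+1.
exists m; split=> // a ma.
have Dm : D / m%:R <= eps / 4.
  rewrite ler_pdivrMr // mulrC -ler_pdivrMr //.
  apply: ltW; apply: lt_le_trans (truncnS_gt _) _.
  by rewrite ler_nat ltnS leq_maxr.
(* the supremum need not be attained, so strictness needs a margin *)
apply: (@le_lt_trans _ _ (eps / 2)%:E); last by rewrite lte_fin; lra.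
apply: ge_ereal_sup => _ [x Kx <-]; rewrite lee_fin.
have wm : (size w <= m)%N by rewrite leqW // leq_maxl.
apply: le_trans (bernstein_partials_error Hf _ wm ma C0 gC gM Kx) _ => //.
by rewrite -/D; lra.
Qed.

End ErrorEstimate.

Theorem theorem6p7 (R : realType) (d : nat) (hd : (0 < d)%N)
    (beta : multiindex d) (f : 'rV[R]_d -> R) (hf : C_class beta f) :
  forall eps : R, 0 < eps ->
    exists N : nat, (0 < N)%N /\
      forall alpha : multiindex d, (forall j, (0 < alpha j)%N) ->
        (forall j, (N <= alpha j)%N) ->
        (sup_norm (unit_cube R d)
           (fun x => (mi_partial beta (bernstein alpha f) x
                      - mi_partial beta f x)%R) < eps%:E)%E.
Proof.
have [Hf cf] : has_mi_partial beta f /\ continuous (mi_partial beta f).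
  by apply: hf; apply/forallP.
move=> eps eps0; have [N [N0 HN]] := bernstein_partials_cvg Hf cf eps0.
by exists N; split=> // alpha _; exact: HN.
Qed.
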